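(* Let $n\ge 4$. Let $\mathscr{M}_{2,m}$ denote the set of isomorphism classes of matroids of rank $2$ on $[m]$, and let $\rho(n)$ denote the number of unordered sums of positive integers equal to $n$ all of whose summands are at least $2$ (i.e. the number of partitions of $n$ into parts $\ge 2$). Then $$|\mathscr{M}_{2,n}|=2|\mathscr{M}_{2,n-1}|-|\mathscr{M}_{2,n-2}|+\rho(n).$$
   Context: Two matroids on $[m]$ are isomorphic if some permutation of $[m]$ maps the bases of one bijectively onto the bases of the other. *)

(* Defs.v *)
From HB Require Import structures.
From mathcomp Require Import all_boot all_order all_algebra all_fingroup.

Set Implicit Arguments.
Unset Strict Implicit.
Unset Printing Implicit Defensive.


Section Matroids.
Variable T : finType.
Implicit Types (Bs : {set {set T}}).

Definition basis_exchange Bs : bool :=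
  [forall A in Bs, forall B in Bs, forall x in A :\: B,
    exists y in B :\: A, (y |: A :\ x) \in Bs].

Definition matroid_axioms Bs : bool := (Bs != set0) && basis_exchange Bs.

Record matroid : Type :=
  Matroid { bases : {set {set T}}; _ : matroid_axioms bases }.

HB.instance Definition _ := [isSub for bases].
HB.instance Definition _ := [Finite of matroid by <:].

(* All bases have the same number of elements (see [card_basis]), so that the
   maximum is their common cardinality. *)
Definition rank (M : matroid) : nat := \max_(B in bases M) #|B|.

Definition isomorphic (M N : matroid) : bool :=
  [exists s : {perm T}, [set s @: (B : {set T}) | B in bases M] == bases N].

End Matroids.

Section MatroidTheory.
Variable T : finType.
Implicit Types (M N : matroid T) (A B : {set T}).

Lemma bases_neq0 M : bases M != set0.
Proof. by case: M => Bs /= /andP[]. Qed.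

Lemma bases_exchange M A B x :
  A \in bases M -> B \in bases M -> x \in A :\: B ->
  exists2 y, y \in B :\: A & (y |: A :\ x) \in bases M.
Proof.
case: M => Bs /= /andP[_ ex] AM BM xAB.
move: ex => /forall_inP/(_ A AM)/forall_inP/(_ B BM)/forall_inP/(_ x xAB).
by case/exists_inP=> y; exists y.
Qed.

Lemma leq_card_bases M A B :
  A \in bases M -> B \in bases M -> #|A| <= #|B|.
Proof.
move: {2}#|A :\: B| (erefl #|A :\: B|) => k.
elim: k A => [|k IHk] A cardAB AM BM.
  by apply: subset_leq_card; rewrite -setD_eq0 -cards_eq0 cardAB.
have /set0Pn[x xAB] : A :\: B != set0 by rewrite -cards_eq0 cardAB.
have [y yBA A'M] := bases_exchange AM BM xAB.
move: (xAB) (yBA); rewrite !inE => /andP[xNB xA] /andP[yNA yB].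
have <- : #|y |: A :\ x| = #|A|.
  by rewrite cardsU1 !inE (negPf yNA) andbF /= (cardsD1 x A) xA.
apply: IHk => //.
have -> : (y |: A :\ x) :\: B = (A :\: B) :\ x.
  apply/setP=> z; rewrite !inE.
  by case: eqVneq => [->|_] /=; rewrite ?yB ?andbF // andbCA.
by move: cardAB; rewrite (cardsD1 x) xAB => -[].
Qed.

Lemma card_basis M B : B \in bases M -> #|B| = rank M.
Proof.
move=> BM; apply/eqP; rewrite eqn_leq; apply/andP; split.
  exact: leq_bigmax_cond.
by apply/bigmax_leqP => A AM; apply: leq_card_bases AM BM.
Qed.

Lemma isomorphicP M N :
  reflect (exists s : {perm T}, [set s @: (B : {set T}) | B in bases M] = bases N)
          (isomorphic M N).
Proof. by apply: (iffP existsP) => -[s /eqP]; exists s => //; apply/eqP. Qed.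

Lemma isomorphic_refl : reflexive (@isomorphic T).
Proof.
move=> M; apply/isomorphicP; exists 1%g.
rewrite -[RHS]imset_id; apply: eq_imset => B.
by rewrite -[RHS]imset_id; apply: eq_imset => x; rewrite perm1.
Qed.

Lemma isomorphic_sym : symmetric (@isomorphic T).
Proof.
suff sym M N : isomorphic M N -> isomorphic N M by move=> M N; apply/idP/idP; apply: sym.
case/isomorphicP=> s sMN; apply/isomorphicP; exists (s^-1)%g.
rewrite -sMN -imset_comp -[RHS]imset_id; apply: eq_imset => B /=.
by rewrite -imset_comp -[RHS]imset_id; apply: eq_imset => x /=; rewrite permK.
Qed.

Lemma isomorphic_trans : transitive (@isomorphic T).
Proof.
move=> N M P /isomorphicP[s sMN] /isomorphicP[t tNP].
apply/isomorphicP; exists (s * t)%g; rewrite -tNP -sMN -imset_comp.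
apply: eq_imset => B /=; rewrite -imset_comp.
by apply: eq_imset => x /=; rewrite permM.
Qed.

Lemma isomorphic_equiv : equivalence_rel (@isomorphic T).
Proof.
apply/equivalence_relP; split; first exact: isomorphic_refl.
by move=> M N MN P; apply/idP/idP; apply: isomorphic_trans; rewrite // isomorphic_sym.
Qed.

End MatroidTheory.

Definition matroid_classes (r m : nat) : {set {set matroid 'I_m}} :=
  equivalence_partition (@isomorphic 'I_m) [set M | rank M == r].

(* Unordered sums are represented by their weakly decreasing list of summands. *)
Definition partition_ge2 (n : nat) (s : seq nat) : bool :=
  [&& sorted geq s, all (leq 2) s & sumn s == n].

(* A partition of [n] has at most [n] parts, each at most [n], so that the bounds
   on the size and on the entries lose nothing (see [partition_ge2_bounded]). *)
Definition rho (n : nat) : nat :=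
  #|[set s : n.-bseq 'I_n.+1 | partition_ge2 n [seq val i | i <- s]]|.

Lemma partition_ge2_bounded n s : partition_ge2 n s ->
  exists t : n.-bseq 'I_n.+1, s = [seq val i | i <- t].
Proof.
case/and3P=> _ s2 /eqP sn.
have size_s : size s <= n.
  rewrite -sn; elim: s s2 {sn} => //= a s IHs /andP[a2 /IHs].
  by rewrite -add1n; apply: leq_add; apply: ltnW.
have s_le i : i \in s -> i < n.+1.
  rewrite ltnS -sn; elim: s {s2 sn size_s} => //= a s IHs.
  rewrite inE => /predU1P[->|/IHs]; first exact: leq_addr.
  by move=> le_i; apply: leq_trans le_i _; apply: leq_addl.
have size_t : size [seq (inord i : 'I_n.+1) | i <- s] <= n by rewrite size_map.
exists (Bseq size_t); rewrite /= -map_comp -[LHS]map_id.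
by apply/eq_in_map => i /s_le lt_i /=; rewrite inordK.
Qed.

(* Main.v *)
Require Import Defs.
From mathcomp Require Import all_boot all_order all_algebra all_fingroup zify.

(* A rank 2 matroid on [n] amounts to a set of loops together with a partition of
   the other elements into at least two parallel classes, the bases being the
   pairs of elements from distinct classes.  Up to isomorphism only the sizes of
   the classes matter, so the isomorphism classes correspond to the partitions,
   with at least two parts, of the integers [j <= n]; writing [p] for the number of
   partitions, |M_{2,n}| - |M_{2,n-1}| = p(n) - 1.  Removing a part equal to 1
   gives p(n) - p(n-1) = rho(n), and the recurrence is the difference of two
   consecutive instances of the first identity. *)

Set Implicit Arguments.
Unset Strict Implicit.
Unset Printing Implicit Defensive.

Lemma geq_total : total geq.
Proof. by move=> a b; apply: leq_total. Qed.

Lemma geq_trans : transitive geq.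
Proof. by move=> a b c ab bc; apply: leq_trans ab. Qed.

Lemma geq_anti : antisymmetric geq.
Proof. by move=> a b ab; apply/eqP; rewrite eqn_leq andbC. Qed.

(** * Counting partitions *)

Definition is_partition (n : nat) (s : seq nat) : bool :=
  [&& sorted geq s, all (leq 1) s & sumn s == n].

(** Positive parts summing to [n] number at most [n], and none exceeds the sum; hence filtering the
    finite type of bounded sequences misses no partition. *)
Lemma is_partition_bounded n s : is_partition n s ->
  exists t : n.-bseq 'I_n.+1, s = [seq val i | i <- t].
Proof.
case/and3P=> _ s_gt0 /eqP sumn_s.
have size_s : size s <= n.
  rewrite -sumn_s; elim: s s_gt0 {sumn_s} => //= a s IHs /andP[a_gt0 /IHs].
  by rewrite -add1n; apply: leq_add.
have s_le i : i \in s -> i < n.+1.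
  rewrite ltnS -sumn_s; elim: s {s_gt0 sumn_s size_s} => //= a s IHs.
  by rewrite inE => /predU1P[->|/IHs]; lia.
have size_t : size [seq (inord i : 'I_n.+1) | i <- s] <= n by rewrite size_map.
exists (Bseq size_t); rewrite /= -map_comp -[LHS]map_id.
by apply/eq_in_map => i /s_le lt_i /=; rewrite inordK.
Qed.

Definition bseq_vals n (t : n.-bseq 'I_n.+1) : seq nat := [seq val i | i <- t].

Lemma bseq_vals_inj n : injective (@bseq_vals n).
Proof. by move=> t u /(inj_map val_inj)/val_inj. Qed.

Definition partitions (n : nat) : seq (seq nat) :=
  [seq s <- [seq bseq_vals t | t : n.-bseq 'I_n.+1] | is_partition n s].

Lemma partitions_uniq n : uniq (partitions n).
Proof. by rewrite filter_uniq // map_inj_uniq ?enum_uniq //; apply: bseq_vals_inj. Qed.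

Lemma mem_partitions n s : (s \in partitions n) = is_partition n s.
Proof.
rewrite mem_filter; case part_s: is_partition => //=.
by have [t ->] := is_partition_bounded part_s; rewrite -/(bseq_vals t) map_f ?mem_enum.
Qed.

Lemma partition_ge2E n s :
  partition_ge2 n s = is_partition n s && all (leq 2) s.
Proof.
rewrite /partition_ge2 /is_partition.
case s2: (all (leq 2) s); last by rewrite !andbF.
by rewrite andbT (sub_all _ s2) // => i /ltnW.
Qed.

Lemma rhoE n : rho n = size [seq s <- partitions n | all (leq 2) s].
Proof.
rewrite /rho cardE -(size_map (@bseq_vals n)).
apply/perm_size/uniq_perm.
- by rewrite map_inj_uniq ?enum_uniq //; apply: bseq_vals_inj.
- by rewrite filter_uniq ?partitions_uniq.
move=> s; rewrite mem_filter mem_partitions andbC -partition_ge2E.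
apply/mapP/idP => [[t]|ps]; first by rewrite mem_enum inE => pt ->.
by have [t def_s] := partition_ge2_bounded ps; exists t; rewrite // mem_enum inE -def_s.
Qed.

(* A partition with a part equal to 1 ends in 1; erase that part. *)
Lemma size_partitionsS n : size (partitions n.+1) = rho n.+1 + size (partitions n).
Proof.
rewrite rhoE -(size_map (rcons^~ 1) (partitions n)) -size_cat; apply/perm_size/uniq_perm.
- exact: partitions_uniq.
- rewrite cat_uniq filter_uniq ?partitions_uniq //= map_inj_uniq ?partitions_uniq ?andbT.
    apply/hasPn => _ /mapP[s _ ->].
    by rewrite mem_filter all_rcons.
  exact: rcons_injl.
(* Read backwards, the list is weakly increasing with head 1, so the only new order condition is
   that all parts are at least 1. *)
have part_rcons s : is_partition n.+1 (rcons s 1) = is_partition n s.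
  rewrite /is_partition all_rcons sumn_rcons addn1 eqSS /=.
  rewrite -(rev_sorted _ s) -(rev_sorted _ (rcons s 1)) rev_rcons /=.
  rewrite path_sortedE; last by move=> a b c; apply: leq_trans.
  by rewrite all_rev; case: (all (leq 1) s); rewrite ?andbF ?andbT.
move=> s; rewrite mem_partitions mem_cat mem_filter mem_partitions.
case s2: (all (leq 2) s) => /=.
  case: (is_partition _ _) => //=; apply/esym/negbTE/mapP => -[t _ def_s].
  by rewrite def_s all_rcons in s2.
apply/idP/mapP => [ps|[t]]; last by rewrite mem_partitions => pt ->; rewrite part_rcons.
suff [t def_s] : exists t, s = rcons t 1.
  by exists t => //; rewrite mem_partitions -part_rcons -def_s.
have /and3P[sorted_s s_gt0 _] := ps.
case/lastP: s s2 s_gt0 sorted_s {ps} => // t a.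
rewrite !all_rcons => t2 /andP[a_gt0 _].
rewrite -rev_sorted rev_rcons /= path_sortedE; last by move=> ???; apply: leq_trans.
rewrite all_rev => /andP[t_ge_a _]; exists t; congr rcons.
(* The last part is the smallest: were it above 1, all parts would be at least 2. *)
have [a_gt1|a_le1] := ltnP 1 a; last by apply/eqP; rewrite eqn_leq a_le1.
case/negP: (negbT t2); rewrite a_gt1 /=.
by apply: sub_all t_ge_a => i; apply: leq_trans.
Qed.

(** The possible lists of parallel class sizes, grouped by their sum, which is the number of
    non-loops; the sum 0 contributes nothing, as two classes are required. *)
Fixpoint rank2_types (n : nat) : seq (seq nat) :=
  if n is m.+1 then rank2_types m ++ [seq s <- partitions n | 1 < size s] else [::].

Lemma mem_rank2_types n s :
  (s \in rank2_types n) =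
  [&& sorted geq s, all (leq 1) s, sumn s <= n & 1 < size s].
Proof.
elim: n => [|n IHn] /=.
  by case: s => [|a [|b s]] //=; rewrite ?andbF //; apply/esym/negP => /and4P[_ /and3P[] ]; lia.
rewrite mem_cat IHn mem_filter mem_partitions /is_partition [sumn s <= n.+1]leq_eqVlt ltnS.
by case: sorted; case: all; case: (1 < size s); rewrite /= ?andbT ?andbF // orbC.
Qed.

Lemma rank2_types_uniq n : uniq (rank2_types n).
Proof.
elim: n => //= n IHn; rewrite cat_uniq IHn filter_uniq ?partitions_uniq // andbT.
apply/hasPn => s; rewrite mem_filter mem_partitions => /andP[_ /and3P[_ _ /eqP sn]].
by rewrite mem_rank2_types sn ltnn !andbF.
Qed.

(** The successor on the left pays for [[:: n.+1]], the only partition of [n.+1] with fewer than two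
    parts. *)
Lemma size_rank2_typesS n :
  (size (rank2_types n.+1)).+1 = size (rank2_types n) + size (partitions n.+1).
Proof.
rewrite size_cat -addnS; congr addn.
rewrite -(count_predC (fun s => 1 < size s) (partitions n.+1)) size_filter -addn1.
congr addn; rewrite -size_filter; apply/esym/(@perm_size _ _ [:: [:: n.+1]])/uniq_perm => //.
  by rewrite filter_uniq ?partitions_uniq.
move=> s; rewrite mem_filter mem_partitions mem_seq1 /is_partition /=.
case: s => [|a [|b s]] //=; last by rewrite eqseq_cons andbF.
by rewrite addn0 andbT eqseq_cons eqxx andbT; case: a.
Qed.

(** * Rank 2 matroids and colorings *)

Section Coloring.
Variable T : finType.
Implicit Types (M N : matroid T) (s : seq nat) (c : T -> nat).

(* [c] gives colour [size s] to the loops and colour [j < size s] to the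
   elements of a parallel class with [nth 0 s j] elements. *)
Definition coloring M s c : Prop :=
  [/\ forall x y,
        ([set x; y] \in bases M) = [&& c x < size s, c y < size s & c x != c y],
      forall x, c x <= size s
    & forall j, j < size s -> #|[set x | c x == j]| = nth 0 s j].

Definition nonloop M : {set T} := [set x | [exists y, [set x; y] \in bases M]].

(** In rank 2 the class of a non-loop [x] contains [x], because [[set x; x]] is a singleton and so
    not a basis. *)
Definition parallel_class M x : {set T} :=
  [set y in nonloop M | [set x; y] \notin bases M].

Definition parallel_classes M : {set {set T}} :=
  [set parallel_class M x | x in nonloop M].

(** This turns out to be a complete isomorphism invariant in rank 2; the number of loops is what the
    sum leaves of [#|T|]. *)
Definition parallel_type M : seq nat :=
  sort geq [seq #|B| | B : {set T} <- enum (parallel_classes M)].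

Lemma mem_parallel_class M x y :
  (y \in parallel_class M x) = (y \in nonloop M) && ([set x; y] \notin bases M).
Proof. by rewrite in_set. Qed.

Lemma basis2P M B : rank M = 2 -> B \in bases M ->
  exists x y, x != y /\ B = [set x; y].
Proof. by move=> rkM BM; apply/cards2P; rewrite (card_basis BM) rkM. Qed.

Lemma pair_basis_neq M x y : rank M = 2 -> [set x; y] \in bases M -> x != y.
Proof. by move=> rkM /card_basis; rewrite rkM cards2; case: eqVneq. Qed.

Lemma nonloopP M x :
  reflect (exists y, [set x; y] \in bases M) (x \in nonloop M).
Proof. by rewrite inE; apply: existsP. Qed.

Lemma pair_basis_nonloop M x y : [set x; y] \in bases M ->
  x \in nonloop M /\ y \in nonloop M.
Proof. by move=> xyM; split; apply/nonloopP; [exists y | exists x; rewrite setUC]. Qed.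

(* Transitivity of parallelism, in contrapositive form. *)
Lemma basis_split M x y z : rank M = 2 -> y \in nonloop M ->
  [set x; z] \in bases M -> ([set x; y] \in bases M) || ([set y; z] \in bases M).
Proof.
move=> rkM /nonloopP[w ywM] xzM; rewrite (setUC [set x]).
have yw := pair_basis_neq rkM ywM.
have [|w_xz] := boolP (w \in [set x; z]).
  by rewrite !inE => /pred2P[] <-; rewrite ywM ?orbT.
have wD : w \in [set y; w] :\: [set x; z] by rewrite !inE eqxx orbT andbT -in_set2.
(* Exchanging [w] out of [[set y; w]] keeps [y] and brings in [x] or [z]. *)
have [u uD uM] := bases_exchange ywM xzM wD.
have def_uy : u |: [set y; w] :\ w = [set y; u].
  apply/setP=> v; rewrite !inE.
  by case: (eqVneq v w) => [->|_]; rewrite ?andbF ?orbF /= ?(eq_sym w y) ?(negPf yw) // orbC.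
move: uM uD; rewrite def_uy !inE => uM /andP[_ /pred2P[]] def_u;
  by rewrite -def_u uM ?orbT.
Qed.

Lemma eq_parallel_class M x y : rank M = 2 -> x \in nonloop M -> y \in nonloop M ->
  (parallel_class M x == parallel_class M y) = ([set x; y] \notin bases M).
Proof.
move=> rkM xM yM; apply/eqP/idP => [eq_cl|xyM].
  have: y \in parallel_class M y.
    by rewrite inE yM; apply/negP => /pair_basis_neq; rewrite eqxx => /(_ rkM).
  by rewrite -eq_cl inE => /andP[].
apply/setP=> z; rewrite !mem_parallel_class.
congr (_ && ~~ _); apply/idP/idP => zM.
  by have := basis_split rkM yM zM; rewrite (negPf xyM).
by have := basis_split rkM xM zM; rewrite setUC (negPf xyM).
Qed.

(** The colors partition [T]; consequently [s] also determines how many elements carry the loop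
    color. *)
Lemma card_color_classes s c : (forall x, c x <= size s) ->
  (forall j, j < size s -> #|[set x | c x == j]| = nth 0 s j) ->
  sumn s + #|[set x | c x == size s]| = #|T|.
Proof.
move=> c_le cards; rewrite -[RHS]sum1_card.
rewrite (partition_big (fun x => inord (c x) : 'I_(size s).+1) predT) //=.
rewrite big_ord_recr /= sumnE (big_nth 0) big_mkord; congr (_ + _).
  apply: eq_bigr => j _; rewrite -cards // -sum1_card.
  by apply: eq_bigl => x; rewrite !inE -val_eqE /= inordK ?ltnS.
by rewrite -sum1_card; apply: eq_bigl => x; rewrite !inE -val_eqE /= inordK ?ltnS.
Qed.

Lemma color_surj s c : all (leq 1) s ->
  (forall j, j < size s -> #|[set x | c x == j]| = nth 0 s j) ->
  forall j, j < size s -> exists x, c x = j.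
Proof.
move=> s_gt0 cards j lt_j; have: 0 < #|[set x | c x == j]|.
  by rewrite cards // (allP s_gt0) ?mem_nth.
by case/card_gt0P => x; rewrite inE => /eqP; exists x.
Qed.

Lemma exists_coloring M : rank M = 2 ->
  exists c, coloring M (parallel_type M) c.
Proof.
move=> rkM; set cl := parallel_class M.
(* Sorting the classes themselves, rather than their sizes, makes the position of a class in [bl] a
   color matching the position of its size in the type. *)
pose bl := sort (relpre (fun B : {set T} => #|B|) geq) (enum (parallel_classes M)).
have typeE : parallel_type M = [seq #|B| | B : {set T} <- bl].
  by rewrite /parallel_type sort_map.
have uniq_bl : uniq bl by rewrite sort_uniq enum_uniq.
have mem_bl B : (B \in bl) = (B \in parallel_classes M) by rewrite mem_sort mem_enum.
have cl_bl x : x \in nonloop M -> cl x \in bl by move=> xM; rewrite mem_bl imset_f.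
pose c x := if x \in nonloop M then index (cl x) bl else size bl.
have c_lt x : (c x < size bl) = (x \in nonloop M).
  by rewrite /c; case: ifP => [xM|_]; rewrite ?index_mem ?cl_bl ?ltnn.
exists c; rewrite /coloring typeE size_map; split=> [x y|x|j lt_j].
- rewrite !c_lt; have [xM|xM] := boolP (x \in nonloop M); last first.
    by apply/negP => /pair_basis_nonloop[]; rewrite (negPf xM).
  have [yM|yM] := boolP (y \in nonloop M); last first.
    by apply/negP => /pair_basis_nonloop[_]; rewrite (negPf yM).
  rewrite /= -[LHS]negbK -eq_parallel_class // /c xM yM; congr negb.
  apply/eqP/eqP => [eq_cl|eq_i]; first by congr index.
  by rewrite -[LHS](nth_index set0 (cl_bl x xM)) eq_i nth_index ?cl_bl.
- by rewrite /c; case: ifP => _; rewrite ?index_size.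
rewrite (nth_map set0) //; set B := nth _ _ _.
have /imsetP[x xM defB] : B \in parallel_classes M by rewrite -mem_bl mem_nth.
congr #|pred_of_set _|; apply/setP=> y; rewrite inE.
have [yM|yM] := boolP (y \in nonloop M); last first.
  rewrite defB inE (negPf yM) /c (negPf yM); apply/eqP => ej.
  by rewrite ej ltnn in lt_j.
rewrite defB inE yM /= -eq_parallel_class // -defB /c yM.
apply/eqP/eqP => [def_j|eq_B]; first by rewrite /B -def_j nth_index ?cl_bl.
by rewrite /cl -eq_B index_uniq.
Qed.

Lemma parallel_type_sorted M : sorted geq (parallel_type M).
Proof. exact: (sort_sorted geq_total). Qed.

Lemma parallel_type_gt0 M : rank M = 2 -> all (leq 1) (parallel_type M).
Proof.
move=> rkM; rewrite all_sort; apply/allP => _ /mapP[B B_M ->].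
move: B_M; rewrite mem_enum => /imsetP[x xM ->]; apply/card_gt0P; exists x.
by rewrite inE xM; apply/negP => /pair_basis_neq; rewrite eqxx => /(_ rkM).
Qed.

Lemma size_parallel_type M : rank M = 2 -> 1 < size (parallel_type M).
Proof.
move=> rkM; have [c [c_bases _ _]] := exists_coloring rkM.
have /set0Pn[B BM] := bases_neq0 M; have [x [y [_ defB]]] := basis2P rkM BM.
by move: BM; rewrite defB c_bases => /and3P[]; lia.
Qed.

Lemma sumn_parallel_type M : rank M = 2 -> sumn (parallel_type M) <= #|T|.
Proof.
move=> rkM; have [c [_ c_le cards]] := exists_coloring rkM.
by rewrite -(card_color_classes c_le cards) leq_addr.
Qed.

(** The colors below [size s] mark exactly the non-loops, and their color classes are the parallel
    classes; a sorted list is determined by its multiset of entries. *)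
Lemma coloring_type M s c : sorted geq s -> all (leq 1) s -> 1 < size s ->
  coloring M s c -> parallel_type M = s.
Proof.
move=> sorted_s s_gt0 size_s [c_bases c_le cards].
have color_ex := color_surj s_gt0 cards.
have mem_nl x : (x \in nonloop M) = (c x < size s).
  apply/nonloopP/idP => [[y]|lt_x]; first by rewrite c_bases => /and3P[].
  (* The boolean read as a number is a color other than [c x]: 1 if [c x] is 0, and 0 otherwise. *)
  have [y cy] : exists y, c y = (c x == 0) by apply: color_ex; lia.
  by exists y; rewrite c_bases lt_x cy; lia.
have clE x : c x < size s -> parallel_class M x = [set y | c y == c x].
  move=> lt_x; apply/setP=> y; rewrite mem_parallel_class [RHS]in_set mem_nl c_bases lt_x /=.
  by case: (ltnP (c y)) => [_|ge_y] /=; rewrite ?negbK 1?eq_sym //; lia.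
apply: (sorted_eq geq_trans geq_anti) => //; first exact: parallel_type_sorted.
rewrite perm_sort.
have -> : s = [seq #|B| | B : {set T} <- [seq [set x | c x == j] | j <- iota 0 (size s)]].
  rewrite -map_comp -[LHS](mkseq_nth 0); apply/eq_in_map => j.
  by rewrite mem_iota /= => lt_j; rewrite cards.
apply/perm_map/uniq_perm; first exact: enum_uniq.
  (* Distinct colors give distinct classes because each class is nonempty. *)
  rewrite map_inj_in_uniq ?iota_uniq // => i j.
  rewrite !mem_iota /= => /color_ex[x cx] _ /setP/(_ x).
  by rewrite !inE cx eqxx => /esym/eqP.
move=> B; rewrite mem_enum; apply/imsetP/mapP => [[x]|[j]].
  by rewrite mem_nl => lt_x ->; exists (c x); rewrite ?mem_iota ?clE.
rewrite mem_iota /= => lt_j ->; have [x cx] := color_ex j lt_j.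
by exists x; rewrite ?mem_nl ?clE ?cx.
Qed.

(** The coloring of [N] is pulled back along the permutation, which preserves the sizes of color
    classes. *)
Lemma coloring_isomorphic M N s c :
  isomorphic M N -> coloring N s c -> exists d, coloring M s d.
Proof.
case/isomorphicP=> f defN [c_bases c_le cards]; exists (c \o f).
split=> [x y|x|j lt_j] /=; rewrite ?c_le // -?c_bases.
  have -> : [set f x; f y] = f @: [set x; y] by rewrite imsetU !imset_set1.
  by rewrite -defN mem_imset //; apply/imset_inj/perm_inj.
rewrite -cards // -(card_preimset [set x | c x == j] (@perm_inj _ f)).
by apply: eq_card => x; rewrite !inE.
Qed.

(** * Matroids built from colorings *)

Definition coloring_bases s c : {set {set T}} :=
  [set B | [exists x, [exists y,
     [&& B == [set x; y], c x < size s, c y < size s & c x != c y]]]].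

Lemma coloring_basesP s c B :
  reflect (exists x y, [/\ B = [set x; y], c x < size s, c y < size s & c x != c y])
          (B \in coloring_bases s c).
Proof.
rewrite inE; apply: (iffP existsP) => [[x /existsP[y /and4P[/eqP-> ? ? ?]]]|].
  by exists x, y.
by case=> x [y [-> ? ? ?]]; exists x; apply/existsP; exists y; apply/and4P.
Qed.

(** When [a] leaves [[set a; b]], the two elements of the other basis have distinct colors, so one
    of them has a color other than that of [b] and can replace [a]. *)
Lemma coloring_bases_matroid s c : 1 < size s ->
  (forall j, j < size s -> exists x, c x = j) -> matroid_axioms (coloring_bases s c).
Proof.
move=> size_s color_ex; apply/andP; split.
  have [x cx] := color_ex 0 (ltnW size_s); have [y cy] := color_ex 1 size_s.
  apply/set0Pn; exists [set x; y]; apply/coloring_basesP; exists x, y.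
  by rewrite cx cy (ltnW size_s).
apply/forall_inP => A /coloring_basesP A_c; apply/forall_inP => B /coloring_basesP.
case=> [z [w [-> lt_z lt_w zw]]]; apply/forall_inP => a aAB.
have [b [defA lt_a lt_b ab]] :
    exists b, [/\ A = [set a; b], c a < size s, c b < size s & c a != c b].
  case: A_c aAB => x [y [-> lt_x lt_y xy]]; rewrite !inE => /andP[_ /pred2P[]] ->.
    by exists y.
  by exists x; rewrite setUC eq_sym.
have [u uB [lt_u ub]] : exists2 u, u \in [set z; w] & c u < size s /\ c u != c b.
  have [zb|zb] := eqVneq (c z) (c b); last by exists z; rewrite ?inE ?eqxx.
  by exists w; rewrite ?inE ?eqxx ?orbT // -zb eq_sym.
have uNA : u \notin A.
  rewrite defA !inE negb_or; apply/andP; split; last by apply: contraNneq ub => ->.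
  by apply: contraTneq aAB => <-; rewrite inE uB.
apply/exists_inP; exists u; first by rewrite inE uNA.
apply/coloring_basesP; exists u, b; split=> //.
rewrite defA; apply/setP=> v; rewrite !inE.
case: (eqVneq v a) => [->|_] //=; rewrite orbF.
by case: (eqVneq a b) ab => [->|_]; rewrite ?eqxx ?orbF.
Qed.

Lemma coloring_exists_matroid s c : all (leq 1) s -> 1 < size s ->
  (forall x, c x <= size s) ->
  (forall j, j < size s -> #|[set x | c x == j]| = nth 0 s j) ->
  exists2 M, rank M = 2 & coloring M s c.
Proof.
move=> s_gt0 size_s c_le cards.
have color_ex := color_surj s_gt0 cards.
exists (Matroid (coloring_bases_matroid size_s color_ex)).
  set M := Matroid _; have /set0Pn[B BM] := bases_neq0 M.
  rewrite -(card_basis BM); have /coloring_basesP[x [y [-> _ _ xy]]] := BM.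
  by rewrite cards2; case: (eqVneq x y) xy => // ->; rewrite eqxx.
split=> // x y; apply/coloring_basesP/and3P => [[z [w [eq_xy lt_z lt_w zw]]]|[? ? ?]].
  (* Equal pairs match in one of two orders; the other two cases force [z = w], against [zw]. *)
  have : x \in [set z; w] by rewrite -eq_xy !inE eqxx.
  have : y \in [set z; w] by rewrite -eq_xy !inE eqxx orbT.
  have : z \in [set x; y] by rewrite eq_xy !inE eqxx.
  have : w \in [set x; y] by rewrite eq_xy !inE eqxx orbT.
  rewrite !inE => + + /pred2P[] ey /pred2P[] ex; rewrite ex ey ?orbb //.
  - by move=> /eqP wz; rewrite wz eqxx in zw.
  - by split; rewrite 1?eq_sym.
  - by move=> _ /eqP wz; rewrite wz eqxx in zw.
by exists x, y.
Qed.

End Coloring.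

(** * Isomorphism and realization by class sizes *)

Lemma count_codom (T : finType) (S : eqType) (e : T -> S) a :
  count_mem a (codom e) = #|[set x | e x == a]|.
Proof.
rewrite count_map -size_filter cardE /enum_mem -filter_predI.
by congr size; apply: eq_filter => x; rewrite !inE andbT.
Qed.

(** Both colorings use every color equally often, so some permutation [f] satisfies [c x = d (f x)];
    as colors decide which pairs are bases, [f] is an isomorphism. *)
Lemma coloring_isom n (M N : matroid 'I_n) s c d : rank M = 2 -> rank N = 2 ->
  coloring M s c -> coloring N s d -> isomorphic M N.
Proof.
move=> rkM rkN [c_bases c_le c_cards] [d_bases d_le d_cards].
have: perm_eq [tuple c i | i < n] [tuple d i | i < n].
  apply/allP => j _; rewrite /= -!/(codom _) !count_codom; apply/eqP.
  case: (ltngtP j (size s)) => [lt_j|gt_j|->].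
  - by rewrite c_cards ?d_cards.
  - rewrite !eq_card0 // => x; rewrite !inE; apply/eqP => ej.
      by have := d_le x; rewrite ej leqNgt gt_j.
    by have := c_le x; rewrite ej leqNgt gt_j.
  - apply: (@addnI (sumn s)).
    by rewrite (card_color_classes c_le c_cards) (card_color_classes d_le d_cards).
case/tuple_permP=> f /val_inj def_c.
have c_f x : c x = d (f x).
  by have := congr1 (fun t => tnth t x) def_c; rewrite !tnth_mktuple.
have f_set2 x y : f @: [set x; y] = [set f x; f y] by rewrite imsetU !imset_set1.
apply/isomorphicP; exists f; apply/setP=> B; apply/imsetP/idP => [[A AM ->]|BN].
  have [x [y [_ defA]]] := basis2P rkM AM.
  by move: AM; rewrite defA f_set2 c_bases d_bases !c_f.
have [x [y [_ defB]]] := basis2P rkN BN.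
exists [set (f^-1)%g x; (f^-1)%g y]; last by rewrite f_set2 !permKV.
by move: BN; rewrite defB c_bases d_bases !c_f !permKV.
Qed.

Lemma exists_color_classes n s : sumn s <= n ->
  exists2 c : 'I_n -> nat, forall x, c x <= size s
    & forall j, j < size s -> #|[set x | c x == j]| = nth 0 s j.
Proof.
move=> sumn_s; set k := size s.
(* The word [l] repeats each color [j] as often as [s] prescribes. Element [i] gets the letter at
   position [i], and the default [k] of [nth] makes the elements past the end of [l] loops. *)
pose l := flatten [seq nseq (nth 0 s j) j | j <- iota 0 k].
have size_l : size l = sumn s.
  rewrite size_flatten /shape -map_comp -[in RHS](mkseq_nth 0 s).
  by congr sumn; apply: eq_map => j /=; rewrite size_nseq.
have codom_c : codom (fun i : 'I_n => nth k l i) = l ++ nseq (n - size l) k.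
  rewrite /codom /image_mem -/(enum 'I_n) (map_comp (nth k l) val) val_enum_ord.
  apply: (@eq_from_nth _ k) => [|i].
    by rewrite size_map size_iota size_cat size_nseq size_l subnKC.
  rewrite size_map size_iota => lt_i; rewrite (nth_map 0) ?size_iota // nth_iota //.
  rewrite nth_cat nth_nseq; case: ltnP => // le_i.
  by rewrite nth_default //; case: ifP.
exists (fun i => nth k l i) => [x|j lt_j].
  have: nth k l x \in l ++ nseq (n - size l) k by rewrite -codom_c codom_f.
  rewrite mem_cat mem_nseq => /orP[/flatten_mapP[j]|/andP[_ /eqP-> //]].
  by rewrite mem_iota mem_nseq /= => lt_j /andP[_ /eqP->]; apply: ltnW.
rewrite -count_codom codom_c count_cat count_nseq /= gtn_eqF // addn0 count_flatten.
rewrite -map_comp sumnE big_map (bigD1_seq j) ?iota_uniq ?mem_iota //=.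
rewrite count_nseq /= eqxx mul1n big1 ?addn0 // => i /negPf ij.
by rewrite count_nseq /= ij.
Qed.

(** An isomorphism transports a coloring by the type of [N] to [M], and a coloring determines the
    type; conversely, equal types yield colorings by the same list. *)
Lemma isomorphic_parallel_type n (M N : matroid 'I_n) : rank M = 2 -> rank N = 2 ->
  isomorphic M N = (parallel_type M == parallel_type N).
Proof.
move=> rkM rkN; have [c cM] := exists_coloring rkM; have [d dN] := exists_coloring rkN.
apply/idP/eqP => [MN|eq_type]; last first.
  by apply: coloring_isom cM _ => //; rewrite eq_type; apply: dN.
have [e eM] := coloring_isomorphic MN dN.
apply: coloring_type eM; first exact: parallel_type_sorted.
  exact: parallel_type_gt0.
exact: size_parallel_type.
Qed.

Lemma parallel_type_surj n s :
  sorted geq s -> all (leq 1) s -> sumn s <= n -> 1 < size s ->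
  exists2 M : matroid 'I_n, rank M = 2 & parallel_type M = s.
Proof.
move=> sorted_s s_gt0 sumn_s size_s.
have [c c_le cards] := exists_color_classes sumn_s.
have [M rkM cM] := coloring_exists_matroid s_gt0 size_s c_le cards.
by exists M => //; apply: coloring_type cM.
Qed.

(** * Counting isomorphism classes *)

(** Maps that identify the same elements of [D] take equally many values there. It serves with [f]
    sending a matroid to its isomorphism class and [g] to its parallel type. *)
Lemma card_imset_ker (T R : finType) (S : eqType) (f : T -> R) (g : T -> S)
    (D : {set T}) (l : seq S) :
  {in D &, forall x y, (f x == f y) = (g x == g y)} ->
  uniq l -> (forall y, y \in l <-> exists2 x, x \in D & g x = y) ->
  #|f @: D| = size l.
Proof.
move=> ker_fg uniq_l mem_l.
have -> : #|f @: D| = size (undup [seq f x | x <- enum D]).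
  rewrite cardE; apply/perm_size/uniq_perm; rewrite ?enum_uniq ?undup_uniq //.
  move=> y; rewrite mem_enum mem_undup.
  by apply/imsetP/mapP => -[x xD ->]; exists x; rewrite ?mem_enum // -mem_enum.
have -> : size l = size (undup [seq g x | x <- enum D]).
  apply/perm_size/uniq_perm; rewrite ?undup_uniq //.
  move=> y; rewrite mem_undup; apply/idP/mapP => [/mem_l[x xD <-]|[x xD ->]].
    by exists x; rewrite ?mem_enum.
  by apply/mem_l; exists x; rewrite // -mem_enum.
have: {subset enum D <= D} by move=> x; rewrite mem_enum.
(* At each element, [undup] drops the value of [f] exactly when it drops that of [g]. *)
elim: (enum D) => //= x r IHr sub_r.
have -> : (f x \in [seq f y | y <- r]) = (g x \in [seq g y | y <- r]).
  apply/mapP/mapP => -[y yr /eqP exy]; exists y => //; apply/eqP; move: exy;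
    by rewrite ker_fg ?sub_r ?inE ?eqxx ?yr ?orbT.
have sub_r' : {subset r <= D} by move=> y yr; rewrite sub_r // inE yr orbT.
by case: ifP => _ /=; rewrite IHr.
Qed.

Lemma card_matroid_classes2 n : #|matroid_classes 2 n| = size (rank2_types n).
Proof.
(* [equivalence_partition] unfolds to the image of the rank 2 matroids under the map to their
   classes. *)
apply: (card_imset_ker (g := @parallel_type 'I_n)); last 2 first.
- exact: rank2_types_uniq.
- move=> s; rewrite mem_rank2_types; split=> [/and4P[sorted_s s_gt0 sumn_s size_s]|].
    have [M rkM typeM] := parallel_type_surj sorted_s s_gt0 sumn_s size_s.
    by exists M; rewrite ?inE ?rkM.
  case=> M; rewrite inE => /eqP rkM <-; apply/and4P; split.
  + exact: parallel_type_sorted.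
  + exact: parallel_type_gt0.
  + by rewrite -[n in _ <= n]card_ord sumn_parallel_type.
  + exact: size_parallel_type.
move=> M N; rewrite !inE => /eqP rkM /eqP rkN; rewrite -isomorphic_parallel_type //.
apply/eqP/idP => [/setP/(_ N)|MN].
  by rewrite !inE rkN isomorphic_refl.
apply/setP=> P; rewrite !inE; congr (_ && _).
by have [_ ->] := isomorphic_equiv M N P.
Qed.

Theorem theorem3p4 (n : nat) (hn : 4 <= n) :
  (#|matroid_classes 2 n|%:Z
     = 2%:Z * #|matroid_classes 2 (n - 1)|%:Z
       - #|matroid_classes 2 (n - 2)|%:Z + (rho n)%:Z)%R.
Proof.
case: n hn => [|[|n]] // _; rewrite !subSS !subn0 !card_matroid_classes2.
(* Here [n] stands for the original [n - 2]. *)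
have := size_rank2_typesS n; have := size_rank2_typesS n.+1.
by have := size_partitionsS n.+1; lia.
Qed.
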